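(* Let $X_1,X_2,\ldots,X_n$ be a sequence of independent random variables with finite second moments, taking values in $\mathbb{Z}_+$, with $p_i:=P(X_i\neq 0)<\log 2$ for $i=1,\dots,n$. Let $\lambda=\sum_{i=1}^n p_i$, $G_i(x)=P(X_i\le x\mid X_i\neq 0)$ and $F(x)=\sum_{i=1}^n \frac{p_i}{\lambda}G_i(x)$. Then $$d_{\mathrm{TV}}\Bigl(\mathcal{L}\sum_{i=1}^n X_i,\ \mathit{CP}(\lambda,F)\Bigr)\le \Bigl(\sum_{i=1}^n p_i^2\Bigr)^2+\frac14\bigl\Vert \Delta^2 f_{\mathit{CP}(\lambda,F)}\bigr\Vert_1\sum_{i=1}^n\frac{(E X_i)^2}{1-2(1-\mathrm{e}^{-p_i})}.$$
   Context: $\mathbb{Z}_+=\{0,1,2,\ldots\}$; $\mathcal{L}X$ denotes the distribution of $X$. For distributions on $\mathbb{Z}$, $d_{\mathrm{TV}}(\mathcal{L}X,\mathcal{L}Y)=\sup_{A\subseteq\mathbb{Z}}|P(X\in A)-P(Y\in A)|=\frac12\sum_{k\in\mathbb{Z}}|P(X=k)-P(Y=k)|$. $\mathit{CP}(\lambda,F)$ is the compound Poisson distribution with Poisson parameter $\lambda$ and compounding c.d.f. $F$, i.e. the distribution of $\sum_{i=1}^N W_i$ where $N$ is Poisson with mean $\lambda$ and the $W_i$ are i.i.d. with c.d.f. $F$, independent of $N$; $f_{\mathit{CP}(\lambda,F)}:\mathbb{Z}\to\mathbb{R}$ is its probability mass function. For $f:\mathbb{Z}\to\mathbb{R}$, $\Delta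 f(i)=f(i)-f(i-1)$, $\Delta^2 f=\Delta(\Delta f)$, and $\Vert \Delta^2 f\Vert_1=\sum_{z\in\mathbb{Z}}|\Delta^2 f(z)|$. Indices with $p_i=0$ contribute nothing to $F$; if $\lambda=0$, $\mathit{CP}(\lambda,F)$ is the point mass at $0$. *)

(* Defs.v *)
From HB Require Import structures.
From mathcomp Require Import all_boot all_order all_algebra.
From mathcomp Require Import all_classical all_reals all_analysis.

Set Implicit Arguments.
Unset Strict Implicit.
Unset Printing Implicit Defensive.

Import Order.TTheory GRing.Theory Num.Theory.
Import numFieldNormedType.Exports.

Local Open Scope classical_set_scope.
Local Open Scope ring_scope.

(* Mutual independence: the product rule for every finite subfamily. *)
Definition mutually_independent (d : measure_display) (T : measurableType d)
    (R : realType) (P : probability T R) (I : choiceType) (X : I -> T -> R) :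
    Prop :=
  forall (s : seq I) (A : I -> set R), uniq s ->
    (forall i, measurable (A i)) ->
    P [set t | forall i, i \in s -> A i (X i t)] =
    (\prod_(i <- s) P (X i @^-1` A i))%E.

(* P(Y <> 0) *)
Definition prob_neq0 (d : measure_display) (T : measurableType d)
    (R : realType) (P : probability T R) (Y : T -> R) : R :=
  fine (P [set t | Y t != 0]).

(* P(Y <= x | Y <> 0); equal to 0 when P(Y <> 0) = 0, since x / 0 = 0. *)
Definition cond_cdf_neq0 (d : measure_display) (T : measurableType d)
    (R : realType) (P : probability T R) (Y : T -> R) (x : R) : R :=
  fine (P [set t | Y t <= x /\ Y t != 0]) / prob_neq0 P Y.

(* mu = CP(lam, F): mu is the law of W_0 + ... + W_(N-1), where N is Poisson
   with mean lam and the W_i have c.d.f. F, all of N, W_0, W_1, ... being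
   independent. When lam = 0 it is the point mass at 0 and F is irrelevant (it
   need not be a c.d.f.). *)
Definition is_compound_poisson (R : realType) (lam : R) (F : R -> R)
    (mu : set R -> \bar R) : Prop :=
  (lam = 0 /\ forall A : set R, measurable A -> mu A = \d_(0 : R) A) \/
  (0 < lam /\
   exists (d : measure_display) (T : measurableType d) (P : probability T R)
          (N : {RV P >-> nat}) (W : nat -> {RV P >-> R}),
     [/\ forall k : nat, P (N @^-1` [set k]) = (poisson_pmf lam k)%:E,
         forall (i : nat) (x : R), cdf (W i) x = (F x)%:E,
         mutually_independent P
           (fun (k : nat) (t : T) => if k is i.+1 then W i t else (N t)%:R) &
         forall A : set R, measurable A ->
           mu A = pushforward P (fun t : T => \sum_(0 <= i < N t) W i t) A]).

(* Distributions on the integers are represented as measures on R concentrated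
   on the image of int; the supremum ranges over all sets of integers. *)
Definition dTV (R : realType) (mu nu : set R -> \bar R) : \bar R :=
  ereal_sup [set `|mu (intr @` A) - nu (intr @` A)|%E | A in [set: set int]].

Definition int_pmf (R : realType) (mu : set R -> \bar R) (z : int) : R :=
  fine (mu [set z%:~R]).

Definition bdiff (R : realType) (f : int -> R) (z : int) : R :=
  f z - f (z - 1).

Definition l1norm (R : realType) (f : int -> R) : \bar R :=
  (\esum_(z in [set: int]) `|f z|%:E)%E.

(* Main.v *)
Require Import Defs.
From HB Require Import structures.
From mathcomp Require Import all_boot all_order all_algebra.
From mathcomp Require Import all_classical all_reals all_analysis.
From mathcomp Require Import measurable_realfun zify ring lra.

(** Write [mu_i] for the law of [X_i] and [H_i = mu_i - delta_0] in the
    convolution algebra of signed measures on the nonnegative integers.  Then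
    the law of the sum is the product of the [A_i = 1 + H_i], the compound
    Poisson law is the product [c] of the [B_i = exp H_i], and with
    [D_i = A_i - B_i] a telescoping argument gives

      prod A_i - prod B_i = sum_i D_i prod_(j != i) B_j + remainder,

    where the remainder is a sum over pairs [k < i] of products of [D_k], [D_i]
    and probability measures; its norm is at most half the square of
    [sum_i |D_i|] (lemma [pnorm_prodB_linear]).  Since [|D_i| <= 2 p_i^2]
    ([pnorm_cbernB_cpois_le]), halving norms to get total variation yields
    [(sum_i p_i^2)^2].

    In the linear part, [D_i prod_(j != i) B_j = ((1 + H_i) exp(-H_i) - 1) c].
    The generating function of [-H_i] is [L_i = 1 - E z^X_i = (1 - z) U_i(z)],
    with [U_i] the generating function of the tails [P(X_i > k)], whose mass is
    [E X_i].  The function [s |-> (1 - s L_i) exp(s L_i) c] has derivative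
    [- s L_i^2 exp(s L_i) c = - s U_i^2 exp(s L_i) (1 - z)^2 c], and
    [|exp(s L_i)| <= exp(2 p_i)] for [s] between 0 and 1, so integrating over
    [s] produces the factor [1/2 (E X_i)^2 exp(2 p_i)] in front of the norm of
    the second difference of [c] ([pnorm_expL_remainder_le]).  Finally
    [exp(2 p) <= 1 / (1 - 2 (1 - exp(-p)))] when [p < ln 2], because
    [y^2 (2 / y - 1) = 1 - (y - 1)^2] for [y = exp p].

    All of this is carried out on generating functions modulo [z^N], for every
    [N]: the algebra becomes a finite dimensional quotient of the polynomial
    ring, the l1 norm becomes a finite sum, and the exponentials of series
    without constant term become finite sums as well.  Only the very last step,
    [dTV_le_truncated], lets [N] grow, using that both laws are carried by the
    nonnegative integers. *)

Set Implicit Arguments.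
Unset Strict Implicit.
Unset Printing Implicit Defensive.

Import Order.TTheory GRing.Theory Num.Theory.
Import numFieldNormedType.Exports.

Local Open Scope classical_set_scope.
Local Open Scope ring_scope.

(** * Power series modulo X^N and their l1 norm *)

Section Truncated.
Variables (R : realType) (N : nat).
Implicit Types p q r : {poly R}.

Definition eqmX p q := forall k, (k < N)%N -> p`_k = q`_k.

(** The l1 norm of a power series cut at degree [N].  It is submultiplicative,
    because the coefficients of a product below [N] only involve coefficients
    of the factors below [N]. *)
Definition pnorm p : R := \sum_(k < N) `|p`_k|.

Lemma eqmX_refl p : eqmX p p.
Proof. by []. Qed.

Lemma eqmX_sym p q : eqmX p q -> eqmX q p.
Proof. by move=> pq k kN; rewrite pq. Qed.

Lemma eqmX_trans q p r : eqmX p q -> eqmX q r -> eqmX p r.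
Proof. by move=> pq qr k kN; rewrite pq// qr. Qed.

Lemma eqmX_sum I (s : seq I) (F G : I -> {poly R}) :
  (forall i, eqmX (F i) (G i)) -> eqmX (\sum_(i <- s) F i) (\sum_(i <- s) G i).
Proof.
by move=> FG k kN; rewrite !coef_sum; apply: eq_bigr => i _; rewrite FG.
Qed.

Lemma eqmXB p p' q q' : eqmX p p' -> eqmX q q' -> eqmX (p - q) (p' - q').
Proof. by move=> pp qq k kN; rewrite !coefB pp// qq. Qed.

Lemma eqmXM p p' q q' : eqmX p p' -> eqmX q q' -> eqmX (p * q) (p' * q').
Proof.
move=> pp qq k kN; rewrite !coefM; apply: eq_bigr => i _.
rewrite pp ?qq//; first exact: leq_ltn_trans (leq_subr _ _) kN.
by apply: leq_ltn_trans kN; rewrite -ltnS.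
Qed.

Lemma eqmXZ c p q : eqmX p q -> eqmX (c *: p) (c *: q).
Proof. by move=> pq k kN; rewrite !coefZ pq. Qed.

Lemma pnorm_eqmX p q : eqmX p q -> pnorm p = pnorm q.
Proof. by move=> pq; apply: eq_bigr => k _; rewrite pq. Qed.

Lemma pnorm_ge0 p : 0 <= pnorm p.
Proof. exact: sumr_ge0. Qed.

Lemma pnorm0 : pnorm 0 = 0.
Proof. by apply: big1 => k _; rewrite coef0 normr0. Qed.

Lemma pnormD p q : pnorm (p + q) <= pnorm p + pnorm q.
Proof.
by rewrite -big_split/=; apply: ler_sum => k _; rewrite coefD ler_normD.
Qed.

Lemma pnormZ c p : pnorm (c *: p) = `|c| * pnorm p.
Proof. by rewrite mulr_sumr; apply: eq_bigr => k _; rewrite coefZ normrM. Qed.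

Lemma pnormN p : pnorm (- p) = pnorm p.
Proof. by rewrite -scaleN1r pnormZ normrN1 mul1r. Qed.

Lemma pnormB p q : pnorm (p - q) <= pnorm p + pnorm q.
Proof. by rewrite -(pnormN q) pnormD. Qed.

Lemma pnorm_sum I (s : seq I) (P : pred I) (F : I -> {poly R}) :
  pnorm (\sum_(i <- s | P i) F i) <= \sum_(i <- s | P i) pnorm (F i).
Proof.
elim/big_ind2 : _ => //; first by rewrite pnorm0.
by move=> x a y b xa yb; exact: le_trans (pnormD _ _) (lerD xa yb).
Qed.

Lemma pnormC c : pnorm c%:P <= `|c|.
Proof.
rewrite /pnorm; case: N => [|n]; first by rewrite big_ord0.
rewrite big_ord_recl coefC eqxx big1 ?addr0// => i _.
by rewrite coefC normr0.
Qed.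

Lemma pnormM p q : pnorm (p * q) <= pnorm p * pnorm q.
Proof.
have step1 : pnorm (p * q) <=
    \sum_(k < N) \sum_(i < N | (i <= k)%N) `|p`_i| * `|q`_(k - i)|.
  apply: ler_sum => k _; rewrite coefM.
  apply: le_trans (ler_norm_sum _ _ _) _.
  rewrite (big_ord_widen N (fun i => `|p`_i * q`_(k - i)|))//.
  by apply: ler_sum => i _; rewrite normrM.
apply: (le_trans step1); rewrite (exchange_big_dep xpredT)//=.
rewrite {1}/pnorm mulr_suml.
apply: ler_sum => i _; rewrite -mulr_sumr ler_wpM2l//.
rewrite (eq_bigl (fun k : 'I_N => (i <= k)%N))//.
rewrite -(big_mkord (fun k => (i <= k)%N) (fun k => `|q`_(k - i)|)).
rewrite (big_cat_nat (n := i))//=; last exact: ltnW.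
rewrite big_nat_cond big1 ?add0r; last first.
  by move=> k /andP[/andP[_ ki] ik]; move: (leq_trans ki ik); rewrite ltnn.
rewrite -{1}[in X in X <= _](add0n i) big_addn big_mkcond/=.
rewrite [leLHS](_ : _ = \sum_(0 <= k < N - i) `|q`_k|); last first.
  by apply: eq_bigr => k _; rewrite leq_addl addnK.
rewrite big_mkord (big_ord_widen N (fun k => `|q`_k|)) ?leq_subr//.
rewrite [leRHS](bigID (fun k : 'I_N => (k < N - i)%N))/= lerDl.
exact: sumr_ge0.
Qed.

Lemma pnorm1 : pnorm 1 <= 1.
Proof. by apply: le_trans (pnormC 1) _; rewrite normr1. Qed.

Lemma pnormX_le p a m : pnorm p <= a -> pnorm (p ^+ m) <= a ^+ m.
Proof.
move=> pa; elim: m => [|m IH]; first by rewrite !expr0 pnorm1.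
rewrite !exprS (le_trans (pnormM _ _))//.
by apply: ler_pM => //; exact: pnorm_ge0.
Qed.

Lemma pnorm_prod_le1 I (s : seq I) (P : pred I) (F : I -> {poly R}) :
  (forall i, pnorm (F i) <= 1) -> pnorm (\prod_(i <- s | P i) F i) <= 1.
Proof.
move=> F1; elim/big_ind : _ => //; first exact: pnorm1.
move=> x y x1 y1; apply: le_trans (pnormM _ _) _.
by rewrite mulr_ile1// pnorm_ge0.
Qed.

(** Telescoping: replace the factors one at a time, the other factors having
    norm at most 1. *)
Lemma pnorm_prodB_le (I : eqType) (s : seq I) (A B : I -> {poly R}) :
  (forall i, pnorm (A i) <= 1) -> (forall i, pnorm (B i) <= 1) ->
  pnorm (\prod_(i <- s) A i - \prod_(i <- s) B i) <=
  \sum_(i <- s) pnorm (A i - B i).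
Proof.
move=> A1 B1; elim: s => [|i s IH]; first by rewrite !big_nil subrr pnorm0.
rewrite !big_cons.
set a := \prod_(j <- s) A j in IH *; set b := \prod_(j <- s) B j in IH *.
have -> : A i * a - B i * b = (A i - B i) * a + B i * (a - b) by ring.
apply: le_trans (pnormD _ _) _; apply: lerD.
  apply: le_trans (pnormM _ _) _.
  by rewrite ler_piMr ?pnorm_ge0// pnorm_prod_le1.
apply: le_trans (pnormM _ _) _; apply: le_trans IH.
by rewrite ler_piMl ?pnorm_ge0.
Qed.

(** Peeling off one factor, with [a], [b] the remaining products and [t] the
    remaining linear part, [A a - B b - (D b + B t) = D (a - b) + B (a - b - t)]
    where [D = A - B]: the second summand is controlled by induction and the
    first by [pnorm_prodB_le], which adds the cross terms of the square. *)
Lemma pnorm_prodB_linear (I : eqType) (s : seq I) (A B : I -> {poly R}) :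
  uniq s -> (forall i, pnorm (A i) <= 1) -> (forall i, pnorm (B i) <= 1) ->
  pnorm (\prod_(i <- s) A i - \prod_(i <- s) B i -
         \sum_(i <- s) (A i - B i) * \prod_(j <- s | j != i) B j) <=
  2^-1 * (\sum_(i <- s) pnorm (A i - B i)) ^+ 2.
Proof.
move=> + A1 B1; elim: s => [_|i s IH].
  by rewrite !big_nil !subrr pnorm0 expr0n mulr0.
rewrite cons_uniq => /andP[nis /IH{}IH].
have tail : \sum_(k <- s) (A k - B k) * \prod_(j <- i :: s | j != k) B j =
    B i * \sum_(k <- s) (A k - B k) * \prod_(j <- s | j != k) B j.
  rewrite mulr_sumr !big_seq; apply: eq_bigr => k ks.
  rewrite big_cons ifT; first by ring.
  by apply: contraNneq nis => ->.
have head : \prod_(j <- i :: s | j != i) B j = \prod_(j <- s) B j.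
  rewrite big_cons eqxx/= big_seq_cond [RHS]big_seq_cond; apply: eq_bigl => j.
  rewrite andbT; case js: (j \in s) => //=.
  by apply/negP => /eqP ji; rewrite ji (negbTE nis) in js.
rewrite [\sum_(k <- i :: s) (A k - B k) * _]big_cons head tail !big_cons.
have := pnorm_prodB_le s A1 B1.
set a := \prod_(j <- s) A j in IH *; set b := \prod_(j <- s) B j in IH *.
set t := \sum_(k <- s) _ in IH *; set d := A i - B i.
set sg := \sum_(k <- s) pnorm _ in IH * => ab.
have -> : A i * a - B i * b - (d * b + B i * t) =
          d * (a - b) + B i * (a - b - t) by rewrite /d; ring.
apply: le_trans (pnormD _ _) _.
have h1 : pnorm (d * (a - b)) <= pnorm d * sg.
  by apply: le_trans (pnormM _ _) _; rewrite ler_wpM2l ?pnorm_ge0.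
have h2 : pnorm (B i * (a - b - t)) <= 2^-1 * sg ^+ 2.
  apply: le_trans (pnormM _ _) _; apply: le_trans IH.
  by rewrite ler_piMl ?pnorm_ge0.
have := sqr_ge0 (pnorm d); nra.
Qed.

(** ** The truncated exponential *)

Definition expT q : {poly R} := \sum_(m < N) m`!%:R^-1 *: q ^+ m.

Lemma coef0_mulX q : q`_0 = 0 -> exists r, q = r * 'X.
Proof.
move=> q0; have /factor_theorem[r ->] : root q 0.
  by rewrite /root horner_coef0 q0.
by exists r; rewrite polyC0 subr0.
Qed.

Lemma eqmX_exp0 q m : q`_0 = 0 -> (N <= m)%N -> eqmX (q ^+ m) 0.
Proof.
move=> /coef0_mulX[r ->] Nm k kN; rewrite coef0.
rewrite exprMn coefMXn ifT//; exact: leq_trans kN Nm.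
Qed.

Lemma expT_norm_le q (p : R) : pnorm q <= p ->
  pnorm (expT q) <= \sum_(m < N) m`!%:R^-1 * p ^+ m.
Proof.
move=> qp; apply: le_trans (pnorm_sum _ _ _) _.
apply: ler_sum => m _; rewrite pnormZ ger0_norm ?invr_ge0//.
by rewrite ler_wpM2l ?invr_ge0// pnormX_le.
Qed.

Lemma expT0 : eqmX (expT 0) 1.
Proof.
rewrite /eqmX /expT; case: N => [|n] k kn; first by rewrite ltn0 in kn.
rewrite big_ord_recl expr0 fact0 invr1 scale1r big1 ?addr0// => i _.
by rewrite expr0n scaler0.
Qed.

(** In the product of the two truncated exponentials, the pairs of indices
    [i + j < N] recombine by the binomial theorem into the truncated exponential
    of the sum; the other pairs are multiples of ['X^N], since neither argument
    has a constant term. *)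
Lemma expTD p q : p`_0 = 0 -> q`_0 = 0 -> eqmX (expT (p + q)) (expT p * expT q).
Proof.
move=> p0 q0.
pose h i j : {poly R} := (i`!%:R^-1 *: p ^+ i) * (j`!%:R^-1 *: q ^+ j).
have hE : expT p * expT q = \sum_(i < N) \sum_(j < N) h i j.
  by rewrite /expT mulr_suml; apply: eq_bigr => i _; rewrite mulr_sumr.
have hD : expT (p + q) = \sum_(m < N) \sum_(i < N | (i <= m)%N) h i (m - i)%N.
  rewrite /expT; apply: eq_bigr => m _; rewrite addrC exprDn scaler_sumr.
  transitivity (\sum_(i < m.+1) h i (m - i)%N); last first.
    by rewrite (big_ord_widen N (fun i => h i (m - i)%N)).
  apply: eq_bigr => -[i im] _ /=; rewrite /h -scalerAl -scalerAr scalerA.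
  rewrite [q ^+ _ * _]mulrC -scalerMnr scalerMnl -mulr_natr; congr (_ *: _).
  have := bin_fact (im : (i <= m)%N).
  move/(congr1 (fun n => n%:R : R)); rewrite !natrM => <-.
  have i0 : i`!%:R != 0 :> R by rewrite pnatr_eq0 -lt0n fact_gt0.
  have mi0 : (m - i)`!%:R != 0 :> R by rewrite pnatr_eq0 -lt0n fact_gt0.
  have b0 : 'C(m, i)%:R != 0 :> R by rewrite pnatr_eq0 -lt0n bin_gt0.
  by field; rewrite i0 mi0 b0.
move=> k kN; rewrite hE hD (exchange_big_dep xpredT)//=.
rewrite !coef_sum; apply: eq_bigr => i _.
rewrite [in RHS](bigID (fun j : 'I_N => (i + j < N)%N))/= coefD.
rewrite [X in _ = _ + X](_ : _ = 0) ?addr0; last first.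
  rewrite coef_sum big1// => j; rewrite -leqNgt => Nij.
  rewrite /h -scalerAl -scalerAr !coefZ.
  have [a ->] := coef0_mulX p0; have [b ->] := coef0_mulX q0.
  rewrite !exprMn mulrACA -exprD coefMXn ifT ?mulr0//.
  exact: leq_trans kN Nij.
congr (nth 0 (polyseq _) k).
rewrite -(big_mkord (fun m => (i <= m)%N) (fun m => h i (m - i)%N)).
rewrite (big_cat_nat (n := i))//=; last exact: ltnW.
rewrite big_nat_cond big1 ?add0r; last first.
  by move=> m /andP[/andP[_ mi] im]; move: (leq_trans mi im); rewrite ltnn.
rewrite -{1}(add0n i) big_addn big_mkcond/=.
rewrite [LHS](_ : _ = \sum_(0 <= m < N - i) h i m); last first.
  by apply: eq_bigr => m _; rewrite leq_addl addnK.
rewrite big_mkord (big_ord_widen N (fun m => h i m)) ?leq_subr//.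
by apply: eq_bigl => m; rewrite ltn_subRL.
Qed.

Lemma expT_sum I (s : seq I) (P : pred I) (q : I -> {poly R}) :
  (forall i, (q i)`_0 = 0) ->
  eqmX (expT (\sum_(i <- s | P i) q i)) (\prod_(i <- s | P i) expT (q i)).
Proof.
move=> q0; elim: s => [|i s IH]; first by rewrite !big_nil; exact: expT0.
rewrite !big_cons; case: ifP => // _.
apply: eqmX_trans (expTD _ _) _ => //; last exact: eqmXM.
by rewrite coef_sum big1.
Qed.

Lemma eqmX_expT p q :
  eqmX p q -> eqmX (expT p) (expT q).
Proof.
move=> pq; apply: eqmX_sum => m; apply: eqmXZ.
elim: (m : nat) => [|k IH]; first by rewrite !expr0.
by rewrite !exprS; exact: eqmXM.
Qed.

End Truncated.

(** * Comparing 1 + H with exp H *)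

Lemma exp_partial_le (R : realType) (n : nat) (x : R) : 0 <= x ->
  \sum_(m < n) m`!%:R^-1 * x ^+ m <= expR x.
Proof.
move=> x0; have -> : \sum_(m < n) m`!%:R^-1 * x ^+ m = series (exp_coeff x) n.
  rewrite /series/= big_mkord; apply: eq_bigr => m _.
  by rewrite /exp_coeff/= mulrC.
apply: (@nondecreasing_cvgn_le _ (series (exp_coeff x))); last first.
  exact: is_cvg_series_exp_coeff.
apply: nondecreasing_series => m _ _; exact: exp_coeff_ge0.
Qed.

Section Kernel.
Variables (R : realType) (N : nat).
Implicit Types p : R.
Implicit Types q g f : {poly R}.

Lemma pnorm_cpois_le p q : 0 <= p -> pnorm N q <= p ->
  pnorm N (expR (- p) *: expT N q) <= 1.
Proof.
move=> p0 qp; rewrite pnormZ ger0_norm ?expR_ge0// expRN mulrC.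
rewrite ler_pdivrMr ?expR_gt0// mul1r.
exact: le_trans (expT_norm_le qp) (exp_partial_le _ _).
Qed.

Lemma pnorm_cbern_le p q : 0 <= p <= 1 -> pnorm N q <= p ->
  pnorm N ((1 - p)%:P + q) <= 1.
Proof.
move=> /andP[p0 p1] qp; apply: le_trans (pnormD _ _ _) _.
have := pnormC N (1 - p); rewrite ger0_norm ?subr_ge0// => h.
by apply: le_trans (lerD h qp) _; rewrite subrK.
Qed.

(** Coefficientwise in powers of [q] this compares the Bernoulli and Poisson
    laws of parameter [p]: the weights 0, 1 and at least 2 contribute
    [exp(-p) - 1 + p], [p (1 - exp(-p))] and [1 - exp(-p) - p exp(-p)], which add
    up to [2 p (1 - exp(-p)) <= 2 p^2]. *)
Lemma pnorm_cbernB_cpois_le p q : (1 < N)%N -> 0 <= p -> pnorm N q <= p ->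
  pnorm N ((1 - p)%:P + q - expR (- p) *: expT N q) <= 2 * p ^+ 2.
Proof.
move=> N1 p0 qp; rewrite /expT; case: N N1 qp => [|[|n]]// _ qp.
rewrite !big_ord_recl expr0 expr1 invr1 !scale1r.
set t : {poly R} := \sum_(i < n) _.
have -> : (1 - p)%:P + q - expR (- p) *: (1 + (q + t)) =
    (1 - p - expR (- p))%:P + (1 - expR (- p)) *: q - expR (- p) *: t.
  rewrite !scalerDr alg_polyC scalerBl scale1r [in RHS]polyCB; ring.
have ep : 1 - p <= expR (- p) by have := expR_ge1Dx (- p); lra.
have e1 : expR (- p) <= 1 by rewrite -[leRHS]expR0 ler_expR oppr_le0.
have tn : pnorm n.+2 t <= expR p - 1 - p.
  have : pnorm n.+2 t <=
      \sum_(i < n) (bump 0 (bump 0 i))`!%:R^-1 * p ^+ bump 0 (bump 0 i).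
    apply: le_trans (pnorm_sum _ _ _ _) _.
    apply: ler_sum => m _; rewrite pnormZ ger0_norm ?invr_ge0//.
    by rewrite ler_wpM2l ?invr_ge0// pnormX_le.
  have := exp_partial_le n.+2 p0.
  rewrite !big_ord_recl expr0 expr1 invr1 !mul1r /=; lra.
apply: le_trans (pnormB _ _ _) _.
apply: le_trans (lerD (pnormD _ _ _) (lexx _)) _.
rewrite !pnormZ.
have h1 := pnormC n.+2 (1 - p - expR (- p)).
have h2 : `|1 - expR (- p)| * pnorm n.+2 q <= (1 - expR (- p)) * p.
  by rewrite ger0_norm ?subr_ge0// ler_wpM2l ?subr_ge0.
have h3 : `|expR (- p)| * pnorm n.+2 t <= 1 - expR (- p) - expR (- p) * p.
  rewrite ger0_norm ?expR_ge0//.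
  apply: (le_trans (ler_wpM2l (expR_ge0 _) tn)).
  by rewrite !mulrBr mulr1 mulrC expRxMexpNx_1.
rewrite ler0_norm in h1; last lra.
have : p * (1 - expR (- p)) <= p * p by rewrite ler_wpM2l//; lra.
rewrite expr2; lra.
Qed.

(** [exp(s L)] modulo ['X^N] for [L = p - q].  The constant term [p] is not
    nilpotent, so it is exponentiated in [R]. *)
Definition expL p q (s : R) : {poly R} := expR (s * p) *: expT N (- s *: q).

Lemma pnorm_expL_le p q s : 0 <= p -> pnorm N q <= p -> 0 <= s <= 1 ->
  pnorm N (expL p q s) <= expR (2 * p).
Proof.
move=> p0 qp /andP[s0 s1]; rewrite pnormZ ger0_norm ?expR_ge0//.
have h : pnorm N (- s *: q) <= p.
  rewrite pnormZ normrN ger0_norm//.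
  by rewrite -[leRHS]mul1r; apply: ler_pM => //; exact: pnorm_ge0.
have h2 := le_trans (expT_norm_le h) (exp_partial_le N p0).
rewrite mulr_natl mulr2n expRD; apply: ler_pM => //; rewrite ?expR_ge0 ?pnorm_ge0//.
by rewrite ler_expR ler_piMl.
Qed.

Definition expL_weight p (m : nat) (s : R) : R :=
  expR (s * p) * ((- s) ^+ m / m`!%:R).

Lemma coef_expLM p q g s k :
  (expL p q s * g)`_k = \sum_(m < N) (q ^+ m * g)`_k * expL_weight p m s.
Proof.
rewrite /expL /expT scaler_sumr mulr_suml coef_sum; apply: eq_bigr => m _.
rewrite scalerA exprZn scalerA -scalerAl coefZ mulrC /expL_weight; congr (_ * _).
by rewrite -mulrA; congr (_ * _); rewrite mulrC.
Qed.

Lemma is_derive_expL_weight p m (s : R) :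
  is_derive s 1 (expL_weight p m)
    (p * expL_weight p m s - (if m is m'.+1 then expL_weight p m' s else 0)).
Proof.
have dN : is_derive s 1 (fun x : R => - x) (- 1).
  exact: is_deriveN.
have de : is_derive s 1 (fun x : R => expR (x * p)) (p * expR (s * p)).
  have dl : is_derive s 1 (fun x : R => x * p) p.
    have -> : (fun x : R => x * p) = p \*: (id : R -> R).
      by apply/funext => x; rewrite /= mulrC.
    rewrite -[X in is_derive _ _ _ X]mulr1; exact: is_deriveZ.
  rewrite mulrC; exact: is_derive1_comp.
have dm : is_derive s 1 (fun x : R => (- x) ^+ m / m`!%:R)
   (- (if m is m'.+1 then (- s) ^+ m' / m'`!%:R else 0)).
  have -> : (fun x : R => (- x) ^+ m / m`!%:R) =
      m`!%:R^-1 \*: ((fun x : R => - x) ^+ m).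
    by apply/funext => x; rewrite /= mulrC; congr (_ * _); rewrite fctE.
  apply: is_derive_eq.
  case: m => [|m]; first by rewrite mul0r scale0r scaler0 oppr0.
  rewrite factS natrM invfM /= /GRing.scale/=.
  have := @pnatr_eq0 R m`!; rewrite eqn0Ngt fact_gt0/= => /negbT m0.
  by field; rewrite m0 nat1r pnatr_eq0.
rewrite [X in is_derive _ _ X _](_ : _ = (fun x : R => expR (x * p)) *
  (fun x : R => (- x) ^+ m / m`!%:R)); last by apply/funext => x.
apply: is_derive_eq.
rewrite /expL_weight /GRing.scale/=; case: m {dm} => [|m]; ring.
Qed.

(** Differentiating the weights turns the sum into [p] times itself minus the
    sum shifted by one power of [q]; the only term lost by the shift carries
    [q ^+ N], which vanishes below degree [N]. *)
Lemma is_derive_expL p q g k (s : R) : (k < N)%N -> q`_0 = 0 ->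
  is_derive s 1 (fun s => (expL p q s * g)`_k)
    (((p%:P - q) * expL p q s * g)`_k).
Proof.
move=> kN q0.
have -> : (fun s => (expL p q s * g)`_k) =
    \sum_(m < N) ((q ^+ m * g)`_k \*: expL_weight p m).
  by apply/funext => x; rewrite coef_expLM fct_sumE.
have -> : ((p%:P - q) * expL p q s * g)`_k =
  \sum_(m < N) ((q ^+ m * g)`_k *: (p * expL_weight p m s -
    (if m : nat is m'.+1 then expL_weight p m' s else 0))).
  rewrite mulrBl mulrBl coefB -mulrA mul_polyC coefZ coef_expLM mulr_sumr.
  have -> : q * expL p q s * g = expL p q s * (q * g) by ring.
  rewrite coef_expLM.
  under [RHS]eq_bigr do rewrite /GRing.scale/= mulrBr.
  rewrite sumrB; congr (_ - _).
    by apply: eq_bigr => m _; rewrite mulrCA.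
  move: kN; case: N => [//|n] kN.
  rewrite big_ord_recr big_ord_recl/= mulr0 add0r mulrA -exprSr.
  rewrite -[X in _ + X = _](_ : 0 = _) ?addr0; last first.
    have /(_ k kN) := @eqmXM _ n.+1 _ _ g g (eqmX_exp0 q0 (leqnn n.+1))
      (@eqmX_refl _ _ g).
    by rewrite mul0r coef0 => ->; rewrite mul0r.
  by apply: eq_bigr => m _; rewrite mulrA -exprSr.
apply: is_derive_sum => m; apply: is_deriveZ; exact: is_derive_expL_weight.
Qed.

Lemma expL0 p q : eqmX N (expL p q 0) 1.
Proof.
rewrite /expL mul0r expR0 scale1r oppr0 scale0r; exact: expT0.
Qed.

(** A norm-valued mean value inequality, reduced to the scalar one by testing
    against the signs [e] of the coefficients of the remainder [y].  With [C]
    the announced bound on [L^2 exp(s L) f], the scalar function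
    [G s = <e, (1 - s L) exp(s L) f> - C s^2 / 2] has derivative
    [- s (<e, L^2 exp(s L) f> + C) <= 0], hence [G 1 <= G 0].  The second
    difference appears because [L = (1 - 'X) U] modulo ['X^N]. *)
Lemma pnorm_expL_remainder_le p q (U f : {poly R}) (M : R) :
  0 <= p -> q`_0 = 0 -> pnorm N q <= p ->
  eqmX N (p%:P - q) ((1 - 'X) * U) -> pnorm N U <= M ->
  pnorm N ((1 - (p%:P - q)) * expL p q 1 * f - f) <=
  2^-1 * (M ^+ 2 * expR (2 * p)) * pnorm N ((1 - 'X) ^+ 2 * f).
Proof.
move=> p0 q0 qp LU UM; set L := p%:P - q in LU *.
set V := pnorm N ((1 - 'X) ^+ 2 * f).
pose y := (1 - L) * expL p q 1 * f - f.
pose C := M ^+ 2 * expR (2 * p) * V.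
have LLC (s : R) : 0 <= s <= 1 -> pnorm N (L * expL p q s * (L * f)) <= C.
  move=> s01.
  have -> : pnorm N (L * expL p q s * (L * f)) =
      pnorm N (U ^+ 2 * (expL p q s * ((1 - 'X) ^+ 2 * f))).
    apply: pnorm_eqmX.
    have -> : L * expL p q s * (L * f) = L * L * (expL p q s * f) by ring.
    have -> : U ^+ 2 * (expL p q s * ((1 - 'X) ^+ 2 * f)) =
      ((1 - 'X) * U) * ((1 - 'X) * U) * (expL p q s * f) by ring.
    by apply: eqmXM => //; exact: eqmXM.
  apply: le_trans (pnormM _ _ _) _; rewrite /C -mulrA.
  apply: ler_pM; rewrite ?pnorm_ge0//; first exact: pnormX_le.
  apply: le_trans (pnormM _ _ _) _.
  by rewrite ler_wpM2r ?pnorm_ge0// pnorm_expL_le.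
pose e k : R := Num.sg (y`_k).
pose hk k (s : R) : R :=
  e k * ((expL p q s * f)`_k - s * (expL p q s * (L * f))`_k).
pose h (s : R) : R := \sum_(k < N) hk k s.
pose G (s : R) : R := h s - C / 2 * s ^+ 2.
have dG (s : R) : is_derive s 1 G
    (- s * (\sum_(k < N) e k * (L * expL p q s * (L * f))`_k) - C * s).
  have d1 (k : 'I_N) : is_derive s 1 (hk k)
     (e k * (- s * (L * expL p q s * (L * f))`_k)).
    have a := is_derive_expL p f s (ltn_ord k) q0.
    have b := is_derive_expL p (L * f) s (ltn_ord k) q0.
    have c : is_derive s 1 (fun x : R => x * (expL p q x * (L * f))`_k)
       (s * (L * expL p q s * (L * f))`_k + (expL p q s * (L * f))`_k).
      have -> : (fun x : R => x * (expL p q x * (L * f))`_k) =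
        (id : R -> R) * (fun x => (expL p q x * (L * f))`_k) by [].
      apply: is_derive_eq; rewrite /GRing.scale/= mulr1; congr (_ + _).
    have -> : hk k = e k \*: ((fun x => (expL p q x * f)`_k) -
        (fun x : R => x * (expL p q x * (L * f))`_k)) by [].
    apply: is_derive_eq; rewrite /GRing.scale/=; congr (_ * _).
    have -> : L * expL p q s * f = expL p q s * (L * f) by ring.
    rewrite -/L; ring.
  have dh : is_derive s 1 h
      (\sum_(k < N) e k * (- s * (L * expL p q s * (L * f))`_k)).
    have -> : h = \sum_(k < N) hk k.
      by apply/funext => x; rewrite fct_sumE.
    exact: is_derive_sum.
  have -> : G = h - (C / 2) \*: ((id : R -> R) ^+ 2).
    by apply/funext => x; rewrite /G !fctE.
  apply: is_derive_eq; rewrite /GRing.scale/= expr1; congr (_ - _); last by field.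
  by rewrite mulr_sumr; apply: eq_bigr => k _; ring.
have [|c] := @MVT R G _ 0 1 ltr01 (fun x _ => dG x).
  by apply: derivable_within_continuous => x _.
rewrite in_itv/= => /andP[c0 c1]; rewrite subr0 mulr1.
rewrite {2}/G expr0n/= mulr0 subr0 /G expr1n mulr1.
have -> : h 0 = \sum_(k < N) e k * f`_k.
  apply: eq_bigr => k _; rewrite /hk mul0r subr0.
  by rewrite (eqmXM (@expL0 p q) (@eqmX_refl _ N f)) ?mul1r.
have h1 : h 1 - \sum_(k < N) e k * f`_k = pnorm N y.
  rewrite -sumrB; apply: eq_bigr => k _; rewrite -mulrBr.
  rewrite mul1r -!coefB /e.
  have -> : expL p q 1 * f - expL p q 1 * (L * f) - f = y by rewrite /y; ring.
  by rewrite -normrEsg.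
rewrite -/y -h1.
have : - \sum_(k < N) e k * (L * expL p q c * (L * f))`_k <= C.
  apply: le_trans (LLC c _); last by rewrite !ltW.
  rewrite -sumrN; apply: ler_sum => k _; apply: le_trans (ler_norm _) _.
  rewrite normrN normrM ler_piMl// /e normr_sg.
  by case: (_ == 0).
rewrite /C => h2 h3.
have : c * (- \sum_(k < N) e k * (L * expL p q c * (L * f))`_k) <=
    c * (M ^+ 2 * expR (2 * p) * V).
  by rewrite ler_wpM2l// ltW.
lra.
Qed.

End Kernel.

(** * Approximation of a product of generating functions *)

Section CompoundPoissonApproximation.
Variables (R : realType) (N : nat) (I : eqType) (s : seq I).
Variables (p M : I -> R) (q U : I -> {poly R}).
Hypotheses (s_uniq : uniq s) (N1 : (1 < N)%N).
Hypotheses (p01 : forall i, 0 <= p i <= 1) (q0 : forall i, (q i)`_0 = 0).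
Hypotheses (qp : forall i, pnorm N (q i) <= p i).
Hypotheses (pqU : forall i, eqmX N ((p i)%:P - q i) ((1 - 'X) * U i)).
Hypotheses (UM : forall i, pnorm N (U i) <= M i).

Let B i := expR (- p i) *: expT N (q i).
Let c := expR (- \sum_(i <- s) p i) *: expT N (\sum_(i <- s) q i).
Let p0 i : 0 <= p i. Proof. by case/andP: (p01 i). Qed.

Lemma cpois_prod : eqmX N c (\prod_(i <- s) B i).
Proof.
rewrite /c /B scaler_prod -expR_sum -sumrN.
exact/eqmXZ/expT_sum.
Qed.

Lemma expL_cpois i : eqmX N (expL N (p i) (q i) 1 * B i) 1.
Proof.
rewrite /expL /B -scalerAl -scalerAr scalerA mul1r expRxMexpNx_1 scale1r.
apply: (@eqmX_trans _ _ (expT N (- 1 *: q i + q i))).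
  apply: eqmX_sym; apply: expTD; rewrite ?coefZ ?q0 ?mulr0//.
by rewrite scaleN1r addNr; exact: expT0.
Qed.

(** Modulo ['X^N] the factor [B i] is invertible with inverse
    [exp(p i - q i)], so that omitting it from the product [c] amounts to
    multiplying [c] by that inverse. *)
Lemma linear_term i : i \in s ->
  eqmX N (((1 - p i)%:P + q i - B i) * \prod_(j <- s | j != i) B j)
    ((1 - ((p i)%:P - q i)) * expL N (p i) (q i) 1 * c - c).
Proof.
move=> si; set P := \prod_(j <- s | j != i) B j.
have cP : eqmX N (B i * P) c.
  by apply: eqmX_sym; rewrite /P -bigD1_seq//; exact: cpois_prod.
have PE : eqmX N P (expL N (p i) (q i) 1 * c).
  apply: (@eqmX_trans _ _ (expL N (p i) (q i) 1 * B i * P)); last first.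
    by rewrite -mulrA; apply: eqmXM.
  apply: eqmX_sym; rewrite -[X in eqmX _ _ X]mul1r; apply: eqmXM => //.
  exact: expL_cpois.
have -> : (1 - p i)%:P + q i = 1 - ((p i)%:P - q i) by rewrite polyCB; ring.
rewrite mulrBl -mulrA; apply: eqmXB => //; exact: eqmXM.
Qed.

(** The bound on generating functions: remainder and linear part of the
    telescoping expansion are estimated separately. *)
Theorem cpois_approx :
  pnorm N (\prod_(i <- s) ((1 - p i)%:P + q i) - c) <=
  2 * (\sum_(i <- s) p i ^+ 2) ^+ 2 +
  2^-1 * pnorm N ((1 - 'X) ^+ 2 * c) * \sum_(i <- s) M i ^+ 2 * expR (2 * p i).
Proof.
pose A i := (1 - p i)%:P + q i.
pose t := \sum_(i <- s) (A i - B i) * \prod_(j <- s | j != i) B j.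
have -> : pnorm N (\prod_(i <- s) A i - c) =
    pnorm N (\prod_(i <- s) A i - \prod_(i <- s) B i - t + t).
  by apply: pnorm_eqmX; rewrite subrK; apply: eqmXB => //; exact: cpois_prod.
apply: le_trans (pnormD _ _ _) _; apply: lerD.
  apply: le_trans (@pnorm_prodB_linear _ _ _ s A B s_uniq _ _) _.
  - by move=> i; exact: pnorm_cbern_le.
  - by move=> i; exact: pnorm_cpois_le.
  have : \sum_(i <- s) pnorm N (A i - B i) <= 2 * \sum_(i <- s) p i ^+ 2.
    by rewrite mulr_sumr; apply: ler_sum => i _; exact: pnorm_cbernB_cpois_le.
  have : 0 <= \sum_(i <- s) pnorm N (A i - B i).
    by apply: sumr_ge0 => i _; exact: pnorm_ge0.
  set a := \sum_(i <- s) pnorm N _; set b := \sum_(i <- s) _ => a0 ab.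
  have : a ^+ 2 <= (2 * b) ^+ 2 by rewrite ler_pXn2r ?nnegrE// (le_trans a0).
  rewrite exprMn; lra.
apply: le_trans (pnorm_sum _ _ _ _) _.
rewrite mulr_sumr !big_seq; apply: ler_sum => i si.
rewrite (pnorm_eqmX (linear_term si)).
apply: le_trans (pnorm_expL_remainder_le c (p0 i) (q0 i) (qp i) (pqU i) (UM i)) _.
by rewrite mulrAC.
Qed.

End CompoundPoissonApproximation.

(** * Law of a sum of independent integer-valued variables *)

Section LawSum.
Context (d : measure_display) (T : measurableType d) (R : realType).
Variables (P : probability T R) (I : choiceType) (X : I -> T -> R).
Hypothesis mX : forall i, measurable_fun setT (X i).
Hypothesis indepX : mutually_independent P X.
Variables (N : nat) (a : I -> {poly R}).

(** The constraints on the variables indexed by [r] record the values already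
    fixed when variables are moved out of the sum one at a time. *)
Definition sum_event (s r : seq I) (A : I -> set R) (k : nat) : set T :=
  [set t | (forall i, i \in s -> X i t \is a Num.nat) /\
           \sum_(i <- s) X i t = k%:R /\
           forall j, j \in r -> A j (X j t)].

(** Splitting according to the value of the first summand moves its index from
    [s] to [r] and gives the Cauchy product of the coefficients; independence
    is only used once the sum is empty. *)
Lemma sum_event_law (s r : seq I) (A : I -> set R) (k : nat) :
  uniq (s ++ r) -> (forall i, measurable (A i)) ->
  (forall i, i \in s -> forall l, (l < N)%N ->
     P (X i @^-1` [set l%:R]) = ((a i)`_l)%:E) ->
  (k < N)%N ->
  measurable (sum_event s r A k) /\
  P (sum_event s r A k) =
    (((\prod_(i <- s) a i)`_k)%:E * \prod_(j <- r) P (X j @^-1` A j))%E.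
Proof.
elim: s r A k => [|i s IH] r A k; rewrite /= => ur mA la kN.
  rewrite big_nil coef1 /sum_event.
  case: k kN => [|k] kN.
    have -> : [set t | (forall i, i \in [::] -> X i t \is a Num.nat) /\
        \sum_(i <- [::]) X i t = 0%:R /\ (forall j, j \in r -> A j (X j t))] =
        [set t | forall j, j \in r -> A j (X j t)].
      by apply/seteqP; split => t /=; [case=> _ [] | rewrite big_nil].
    rewrite mul1e; split; last exact: indepX.
    have -> : [set t | forall j, j \in r -> A j (X j t)] =
        \bigcap_(j in [set` r]) (X j @^-1` A j) by [].
    rewrite bigcap_seq.
    elim/big_ind : _ => //; first exact: measurableI.
    by move=> j _; rewrite -[X in measurable X]setTI; exact: mX.
  rewrite [X in measurable X](_ : _ = set0); last first.
    apply/seteqP; split => t //=; rewrite big_nil => -[_ [/esym/eqP]].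
    by rewrite pnatr_eq0.
  rewrite [X in P X](_ : _ = set0); last first.
    apply/seteqP; split => t //=; rewrite big_nil => -[_ [/esym/eqP]].
    by rewrite pnatr_eq0.
  by rewrite measure0 mul0e.
pose A' l j := if j == i then [set l%:R] else A j.
have mA' l j : measurable (A' l j) by rewrite /A'; case: ifP.
have ur' : uniq (s ++ i :: r).
  by rewrite -cat1s uniq_catCA.
have la' j : j \in s -> forall l, (l < N)%N ->
     P (X j @^-1` [set l%:R]) = ((a j)`_l)%:E.
  by move=> js; apply: la; rewrite inE js orbT.
have {}IH l := IH (i :: r) (A' l) (k - l)%N ur' (mA' l) la'
  (leq_ltn_trans (leq_subr _ _) kN).
pose F l := sum_event s (i :: r) (A' l) (k - l)%N.
have nir : i \notin r.
  by move: ur => /andP[]; rewrite mem_cat negb_or => /andP[].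
have FE : sum_event (i :: s) r A k = \big[setU/set0]_(l < k.+1) F l.
  rewrite -bigcup_mkord; apply/seteqP; split => t.
    move=> [nt [st At]].
    have /natrP[l il] : X i t \is a Num.nat by apply: nt; rewrite mem_head.
    have st' : \sum_(j <- s) X j t \is a Num.nat.
      by rewrite big_seq rpred_sum// => j js; apply: nt; rewrite inE js orbT.
    move: st' st => /natrP[m ms]; rewrite big_cons il ms -natrD => /eqP.
    rewrite eqr_nat => /eqP lmk.
    exists l; first by rewrite /= -lmk ltnS leq_addr.
    split; first by move=> j js; apply: nt; rewrite inE js orbT.
    split; first by rewrite ms -lmk addKn.
    move=> j; rewrite inE => /orP[/eqP->|jr]; rewrite /A'.
      by rewrite eqxx.
    by case: eqP => [ji|_]; [rewrite -ji jr in nir|exact: At].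
  move=> [l /= lk [nt [st At]]].
  have il : X i t = l%:R.
    by have := At i (mem_head _ _); rewrite /A' eqxx.
  split.
    by move=> j; rewrite inE => /orP[/eqP->|/nt//]; rewrite il natr_nat.
  split; first by rewrite big_cons il st -natrD subnKC.
  move=> j jr; have := At j; rewrite inE jr orbT => /(_ isT); rewrite /A'.
  by case: eqP => // ji; rewrite -ji jr in nir.
have tF : trivIset setT F.
  move=> l l' _ _ [t [[_ [_ Al]] [_ [_ Al']]]].
  have := Al i (mem_head _ _); have := Al' i (mem_head _ _).
  by rewrite /A' eqxx /= => -> /eqP; rewrite eqr_nat => /eqP.
have mF l : measurable (F l) by have [] := IH l.
rewrite FE; split; first exact: bigsetU_measurable.
have [q qE] : exists q, (\prod_(j <- r) P (X j @^-1` A j) = q%:E)%E.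
  exists (fine (\prod_(j <- r) P (X j @^-1` A j))%E); rewrite fineK//.
  elim/big_ind : _ => // [x y|j _]; first exact: fin_numM.
  by apply: fin_num_measure; rewrite -[X in measurable X]setTI; exact: mX.
rewrite measure_bigsetU// big_cons coefM qE -EFinM mulr_suml -sumEFin.
apply: eq_bigr => l _; apply: etrans (proj2 (IH l)) _.
have lN : (l < N)%N by apply: leq_ltn_trans kN; rewrite -ltnS.
rewrite big_cons {1}/A' eqxx la ?mem_head//.
have -> : (\prod_(j <- r) P (X j @^-1` A' l j) = q%:E)%E.
  rewrite -qE !big_seq; apply: eq_bigr => j jr; rewrite /A'.
  by case: eqP => // ji; rewrite -ji jr in nir.
by rewrite -!EFinM mulrCA mulrA.
Qed.

End LawSum.

(** * From a step distribution function to point masses *)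

Section Lattice.
Context (d : measure_display) (T : measurableType d) (R : realType).
Variables (P : probability T R) (W : {RV P >-> R}) (F : R -> R).
Hypothesis cdfW : forall x, cdf W x = (F x)%:E.
Hypothesis F0 : F 0 = 0.
Hypothesis F_step : forall (k : nat) x, k%:R <= x < k.+1%:R -> F x = F k%:R.

Let mW (B : set R) : measurable B -> measurable (W @^-1` B).
Proof. by move=> mB; exact: measurable_funPTI. Qed.

Lemma prob_itv_cdf (a b : R) : a <= b ->
  P (W @^-1` `]a, b]) = (F b - F a)%:E.
Proof.
move=> ab.
have -> : W @^-1` `]a, b] = W @^-1` `]-oo, b] `\` W @^-1` `]-oo, a].
  apply/seteqP; split => t /=; rewrite !in_itv/=.
    by move=> /andP[aw ->]; rewrite leNgt aw.
  by move=> [-> /negP]; rewrite -ltNge => ->.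
rewrite measureD; [|exact: mW|exact: mW|].
  2: by rewrite ltey_eq fin_num_measure//; exact: mW.
rewrite [X in (_ - P X)%E](_ : _ = W @^-1` `]-oo, a]); last first.
  apply/seteqP; split => t /=; rewrite !in_itv/=; first by case.
  by move=> h; split => //; exact: le_trans ab.
by rewrite EFinB -!cdfW.
Qed.

(** The open interval is the union over [m] of the intervals excluding [k] and
    including [k + 1 - 1/(m + 1)], on which [F] does not increase. *)
Lemma lattice_gap (k : nat) : P.-negligible (W @^-1` `]k%:R, k.+1%:R[).
Proof.
have -> : W @^-1` `]k%:R, k.+1%:R[ =
    \bigcup_n W @^-1` `]k%:R, k.+1%:R - n.+1%:R^-1].
  rewrite -preimage_bigcup; congr (_ @^-1` _).
  apply/seteqP; split => x /=.
    rewrite in_itv/= => /andP[kx xk].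
    exists (Num.truncn (k.+1%:R - x)^-1) => //=; rewrite in_itv/= kx/=.
    rewrite lerBrDl -lerBrDr invf_ple ?posrE ?subr_gt0//.
    by rewrite ltW// truncnS_gt.
  move=> [n _] /=; rewrite !in_itv/= => /andP[-> /le_lt_trans]; apply.
  by rewrite ltrBlDr ltrDl invr_gt0 ltr0n.
apply: negligible_bigcup => n; apply/negligibleP; first exact: mW.
have n1 : n.+1%:R^-1 <= 1 :> R by rewrite invf_le1 ?ltr0n// ler1n.
have ki : k%:R <= k.+1%:R - n.+1%:R^-1 :> R.
  by rewrite -natr1 lerBrDr lerD2l.
apply: etrans (prob_itv_cdf ki) _.
by rewrite (F_step (k := k)) ?subrr// ki/= ltrBlDr ltrDl invr_gt0 ltr0n.
Qed.

Lemma lattice_pos : P (W @^-1` `]-oo, 0]) = 0%E.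
Proof. by have := cdfW 0; rewrite F0. Qed.

Lemma lattice_nat : P.-negligible [set t | W t \isn't a Num.nat].
Proof.
apply: (@negligibleS _ _ _ _ (W @^-1` `]-oo, 0] `|`
    \bigcup_k W @^-1` `]k%:R, k.+1%:R[)).
  move=> t /= nW; have [W0|W0] := leP (W t) 0.
    by left; rewrite /= in_itv/=.
  right; exists (Num.truncn (W t)) => //=; rewrite in_itv/= truncnS_gt andbT.
  rewrite lt_neqAle truncn_le ?ltW// andbT.
  by apply: contra nW => /eqP Wt; rewrite -Wt; rewrite natr_nat.
apply: negligibleU; last by apply: negligible_bigcup => k; exact: lattice_gap.
by apply/negligibleP; [exact: mW|exact: lattice_pos].
Qed.

Lemma lattice_pmf0 : P (W @^-1` [set 0]) = 0%E.
Proof.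
apply: (@subset_measure0 _ _ _ _ _ (W @^-1` `]-oo, 0])).
- exact: mW.
- exact: mW.
- by move=> t /= ->; rewrite in_itv/=.
- exact: lattice_pos.
Qed.

Lemma lattice_pmfS (k : nat) :
  P (W @^-1` [set k.+1%:R]) = (F k.+1%:R - F k%:R)%:E.
Proof.
have kk : k%:R <= k.+1%:R :> R by rewrite ler_nat.
rewrite -prob_itv_cdf//.
have -> : W @^-1` `]k%:R, k.+1%:R] =
    W @^-1` [set k.+1%:R] `|` W @^-1` `]k%:R, k.+1%:R[.
  apply/seteqP; split => t /=; rewrite !in_itv/=.
    by move=> /andP[->]; rewrite le_eqVlt => /orP[/eqP|->]; [left|right].
  case=> [->|/andP[-> /ltW ->//]].
  by rewrite ltr_nat leqnn lexx.
rewrite measureU0; [by []|exact: mW|exact: mW|].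
by apply/negligibleP; [exact: mW|exact: lattice_gap].
Qed.

End Lattice.

(** * Point masses of a compound Poisson law *)

Section CompoundPoisson.
Context (d : measure_display) (T : measurableType d) (R : realType).
Variables (P : probability T R) (lam : R) (Y : {RV P >-> nat}).
Variables (W : nat -> {RV P >-> R}).
Hypothesis lam0 : 0 < lam.
Hypothesis lawY : forall k : nat, P (Y @^-1` [set k]) = (poisson_pmf lam k)%:E.
Hypothesis indep : mutually_independent P
  (fun (k : nat) (t : T) => if k is i.+1 then W i t else (Y t)%:R).
Variables (N : nat) (g : {poly R}).
Hypothesis g0 : g`_0 = 0.
Hypothesis lawW : forall i l, (l < N)%N -> P (W i @^-1` [set l%:R]) = (g`_l)%:E.
Hypothesis W_nat : forall i, P.-negligible [set t | W i t \isn't a Num.nat].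

Let X (k : nat) (t : T) : R := if k is i.+1 then W i t else (Y t)%:R.

Let mX k : measurable_fun setT (X k).
Proof.
case: k => [|k]; last exact: measurable_funPT.
by apply: (@measurableT_comp _ _ _ _ _ _ (fun n : nat => n%:R : R)).
Qed.

Let S t : R := \sum_(0 <= i < Y t) W i t.

Lemma measurable_random_sum : measurable_fun setT S.
Proof.
move=> _ B mB; rewrite setTI.
have -> : S @^-1` B =
  \bigcup_m (Y @^-1` [set m] `&` (fun t => \sum_(0 <= i < m) W i t) @^-1` B).
  apply/seteqP; split => t /=; first by move=> SB; exists (Y t).
  by move=> [m _ [/= <-]].
apply: bigcup_measurable => m _; apply: measurableI.
  exact: measurable_funPTI.
have mf : measurable_fun setT (fun t => \sum_(0 <= i < m) W i t).
  by apply: measurable_sum => i; exact: measurable_funPT.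
by rewrite -[X in measurable X]setTI; exact: mf.
Qed.

Lemma random_sum_nat : P.-negligible [set t | S t \isn't a Num.nat].
Proof.
apply: negligibleS (negligible_bigcup W_nat) => t /= nS.
apply: contrapT => h; move/negP : nS; apply.
rewrite /S rpred_sum// => i _; apply/negPn/negP => nW.
by apply: h; exists i.
Qed.

Let E k m :=
  sum_event X [seq i.+1 | i <- iota 0 m] [:: 0%N] (fun=> [set m%:R]) k.

Lemma random_sum_eventE k m t : E k m t <->
  (forall i, (i < m)%N -> W i t \is a Num.nat) /\ S t = k%:R /\ Y t = m.
Proof.
rewrite /E /sum_event /= big_map.
have YE : (forall j, j \in [:: 0%N] -> X j t = m%:R) <-> Y t = m.
  split => [/(_ 0%N (mem_head _ _))/eqP|Ym j].
    by rewrite eqr_nat => /eqP.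
  by rewrite inE => /eqP ->; rewrite /X Ym.
have WE : (forall i, i \in [seq i.+1 | i <- iota 0 m] -> X i t \is a Num.nat)
    <-> (forall i, (i < m)%N -> W i t \is a Num.nat).
  split => [h i im|h i /mapP[j]].
    by apply: (h i.+1); rewrite map_f// mem_iota.
  by rewrite mem_iota => jm ->; exact: h.
split => [[/WE ? [Sk /YE Ym]]|[/WE ? [Sk Ym]]]; split => //; split => //.
- by rewrite /S Ym /index_iota subn0.
- by rewrite -Sk /S Ym /index_iota subn0.
- exact/YE.
Qed.

(** Conditioning on the number [m] of summands gives the series
    [sum_m P(Y = m) g^m].  As [g] has no constant term, the terms [m >= N] do not
    contribute below degree [N], so the corresponding events form the null set
    [B].  Summands that are not natural numbers are put in a null set too. *)
Lemma compound_poisson_pmf k : (k < N)%N ->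
  P [set t | S t = k%:R] = ((expR (- lam) *: expT N (lam *: g))`_k)%:E.
Proof.
move=> kN.
have EP m : measurable (E k m) /\
    P (E k m) = ((g ^+ m)`_k * poisson_pmf lam m)%:E.
  have [] := @sum_event_law _ _ _ P _ X mX indep N (fun=> g)
    [seq i.+1 | i <- iota 0 m] [:: 0%N] (fun=> [set m%:R]) k _ _ _ kN.
  - rewrite cat_uniq map_inj_uniq ?iota_uniq//=; last exact: succn_inj.
    by rewrite orbF andbT; apply/negP => /mapP[].
  - by move=> _; exact: measurable_set1.
  - by move=> i /mapP[j _ ->] l lN; exact: lawW.
  move=> mE PE; split => //; rewrite [LHS]PE big_seq1 big_map.
  rewrite big_const_seq count_predT size_iota iter_mulr mulr1 EFinM.
  congr (_ * _)%E; rewrite -lawY; congr (P _).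
  by apply/seteqP; split => t /= => [/eqP|->//]; rewrite eqr_nat => /eqP.
have tE : trivIset setT (E k).
  move=> m m' _ _ [t [/random_sum_eventE[_ [_ <-]]]].
  by move=> /random_sum_eventE[_ [_ <-]].
pose A := \big[setU/set0]_(m < N) E k m.
have mA : measurable A by apply: bigsetU_measurable => m _; case: (EP m).
have PA : P A = ((expR (- lam) *: expT N (lam *: g))`_k)%:E.
  rewrite measure_bigsetU//; last by move=> m; case: (EP m).
  rewrite coefZ /expT coef_sum mulr_sumr -sumEFin; apply: eq_bigr => m _.
  apply: etrans (proj2 (EP m)) _; congr (_%:E).
  by rewrite exprZn !coefZ /poisson_pmf lam0; ring.
pose B := \bigcup_m E k (N + m)%N.
have B0 : P.-negligible B.
  apply: negligible_bigcup => m; have [mE PE] := EP (N + m)%N.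
  apply/negligibleP => //; apply: etrans PE _.
  by rewrite (eqmX_exp0 g0 (leq_addr m N))// coef0 mul0r.
have mS : measurable [set t | S t = k%:R].
  rewrite -[X in measurable X]setTI.
  exact: (measurable_random_sum measurableT (measurable_set1 k%:R)).
have [Z [mZ Z0 BZ]] :
    P.-negligible (B `|` \bigcup_i [set t | W i t \isn't a Num.nat]).
  by apply: negligibleU => //; exact: negligible_bigcup.
rewrite -PA; apply/eqP; rewrite eq_le; apply/andP; split.
  rewrite -(measureU0 mA mZ Z0); apply: le_measure; rewrite ?inE//.
    exact: measurableU.
  move=> t /= Sk; have [Zt|Zt] := pselect (Z t); first by right.
  left; rewrite /A -bigcup_mkord.
  have Wn i : W i t \is a Num.nat.
    by apply/negPn/negP => nW; apply: Zt; apply: BZ; right; exists i.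
  have Ek : E k (Y t) t by apply/random_sum_eventE.
  exists (Y t) => //=; rewrite ltnNge; apply/negP => NY.
  by apply: Zt; apply: BZ; left; exists (Y t - N)%N => //; rewrite subnKC.
apply: le_measure; rewrite ?inE// /A -bigcup_mkord => t [m _].
by move=> /random_sum_eventE[_ []].
Qed.

End CompoundPoisson.

(** * Tails of an integer-valued variable *)

Section Tail.
Context (d : measure_display) (T : measurableType d) (R : realType).
Variables (P : probability T R) (Y : {RV P >-> R}).
Hypothesis Y_nat : forall t, Y t \is a Num.nat.

Definition tail (k : nat) : R := fine (P (Y @^-1` `]k%:R, +oo[)).

Let mY (B : set R) : measurable B -> measurable (Y @^-1` B).
Proof. by move=> mB; exact: measurable_funPTI. Qed.

Let finP (A : set T) : measurable A -> P A = (fine (P A))%:E.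
Proof. by move=> mA; rewrite fineK// fin_num_measure. Qed.

Lemma tailE k : P (Y @^-1` `]k%:R, +oo[) = (tail k)%:E.
Proof. by apply: finP; exact: mY. Qed.

Lemma tail_ge0 k : 0 <= tail k.
Proof. exact: fine_ge0. Qed.

Lemma tail_le k l : (k <= l)%N -> tail l <= tail k.
Proof.
move=> kl; rewrite -lee_fin -!tailE; apply: le_measure.
- by rewrite inE; exact: mY.
- by rewrite inE; exact: mY.
move=> t /=; rewrite !in_itv/= !andbT; apply: le_lt_trans.
by rewrite ler_nat.
Qed.

Lemma nat_valued_neq0 : [set t | Y t != 0] = Y @^-1` `]0%:R, +oo[.
Proof.
apply/seteqP; split => t /=; rewrite in_itv/= andbT; last first.
  by move=> ?; rewrite gt_eqF.
have /natrP[m ->] := Y_nat t.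
by rewrite pnatr_eq0 ltr_nat lt0n.
Qed.

Lemma prob_neq0_tail : prob_neq0 P Y = tail 0.
Proof. by rewrite /prob_neq0 nat_valued_neq0. Qed.

Lemma prob_tailB k l : (k <= l)%N ->
  P (Y @^-1` `]k%:R, l%:R]) = (tail k - tail l)%:E.
Proof.
move=> kl; rewrite EFinB -!tailE.
have -> : Y @^-1` `]k%:R, l%:R] = Y @^-1` `]k%:R, +oo[ `\` Y @^-1` `]l%:R, +oo[.
  apply/seteqP; split => t /=; rewrite !in_itv/= !andbT.
    by move=> /andP[-> ]; rewrite leNgt => /negP.
  by move=> [-> /negP]; rewrite -leNgt.
rewrite measureD; [|exact: mY|exact: mY|].
  2: by rewrite ltey_eq fin_num_measure//; exact: mY.
congr (_ - P _)%E; apply/seteqP; split => t /=; first by case.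
rewrite !in_itv/= !andbT => h; split => //; apply: le_lt_trans h.
by rewrite ler_nat.
Qed.

Lemma prob_natS k : P (Y @^-1` [set k.+1%:R]) = (tail k - tail k.+1)%:E.
Proof.
rewrite -prob_tailB//; congr (P _); apply/seteqP; split => t /=.
  by move=> ->; rewrite in_itv/= lexx ltr_nat leqnn.
rewrite in_itv/=; have /natrP[m ->] := Y_nat t.
rewrite ltr_nat ler_nat => /andP[km mk]; congr (_%:R).
by apply/eqP; rewrite eqn_leq mk.
Qed.

Lemma prob_nat0 : P (Y @^-1` [set 0]) = (1 - tail 0)%:E.
Proof.
rewrite EFinB -tailE -nat_valued_neq0 -probability_setC; last first.
  by rewrite nat_valued_neq0; exact: mY.
congr (P _); apply/seteqP; split => t /=; first by move=> ->; rewrite eqxx.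
by move=> /negP/negPn/eqP.
Qed.

Lemma fine_prob_le_neq0 (k : nat) x : k%:R <= x < k.+1%:R ->
  fine (P [set t | Y t <= x /\ Y t != 0]) = tail 0 - tail k.
Proof.
move=> /andP[kx xk].
suff -> : [set t | Y t <= x /\ Y t != 0] = Y @^-1` `]0%:R, k%:R].
  by rewrite prob_tailB.
apply/seteqP; split => t /=; rewrite in_itv/=; have /natrP[m ->] := Y_nat t;
  rewrite pnatr_eq0 ltr_nat ler_nat lt0n.
  by move=> [mx ->]/=; rewrite -ltnS -(ltr_nat R); exact: le_lt_trans xk.
by move=> /andP[-> mk]; split => //; apply: le_trans kx; rewrite ler_nat.
Qed.

Lemma tail0_le1 : tail 0 <= 1.
Proof. by rewrite -lee_fin -tailE probability_le1//; exact: mY. Qed.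

(** The generating function of [Y] restricted to [Y != 0], in terms of tails and
    modulo ['X^N]. *)
Definition jump_poly (N : nat) : {poly R} :=
  \poly_(k < N) (if k is k'.+1 then tail k' - tail k'.+1 else 0).

Definition tail_poly (N : nat) : {poly R} := \poly_(k < N) tail k.

Lemma jump_poly0 N : (jump_poly N)`_0 = 0.
Proof. by rewrite coef_poly; case: ifP. Qed.

Lemma jump_polyP N k : (k < N)%N ->
  P (Y @^-1` [set k%:R]) = (((1 - tail 0)%:P + jump_poly N)`_k)%:E.
Proof.
move=> kN; rewrite coefD coefC coef_poly kN.
by case: k kN => [|k] kN /=; rewrite ?addr0 ?add0r ?prob_nat0 ?prob_natS.
Qed.

Lemma pnorm_jump_poly N : pnorm N (jump_poly N) <= tail 0.
Proof.
have -> : pnorm N (jump_poly N) =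
    \sum_(k < N) (if k : nat is k'.+1 then tail k' - tail k'.+1 else 0).
  apply: eq_bigr => k _; rewrite coef_poly ltn_ord ger0_norm//.
  by case: (k : nat) => [//|k']; rewrite subr_ge0 tail_le.
case: N => [|N]; first by rewrite big_ord0 tail_ge0.
rewrite big_ord_recl add0r/=.
rewrite -(big_mkord xpredT (fun k => tail k - tail k.+1)).
rewrite (@telescope_sumr_eq _ 0 N (fun k => - tail k))//; last first.
  by move=> k _; rewrite opprK addrC.
by rewrite opprK addrC lerBlDr lerDl tail_ge0.
Qed.

(** Summation by parts: [P(Y != 0) - E(z^Y; Y != 0) = 1 - E z^Y] equals
    [(1 - z) sum_k P(Y > k) z^k]. *)
Lemma tail_polyE N : eqmX N ((tail 0)%:P - jump_poly N) ((1 - 'X) * tail_poly N).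
Proof.
move=> k kN; rewrite mulrBl mul1r !coefB coefC coefXM !coef_poly kN.
case: k kN => [|k] kN /=; first by rewrite !subr0.
by rewrite (ltnW kN); ring.
Qed.

Hypothesis Y_sq : ('E_P[fun t : T => (Y t ^+ 2)%R] < +oo)%E.

Let Y_ge0 t : 0 <= Y t.
Proof. by have /natrP[m ->] := Y_nat t. Qed.

(** The sum over [k < N] of the indicators of [Y > k] is [min N Y], at most [Y].
    The bound on the second moment makes [E Y] finite, so that [fine] is exact. *)
Lemma pnorm_tail_poly N : pnorm N (tail_poly N) <= fine 'E_P[Y].
Proof.
have -> : pnorm N (tail_poly N) = \sum_(k < N) tail k.
  by apply: eq_bigr => k _; rewrite coef_poly ltn_ord ger0_norm// tail_ge0.
have EY_fin : ('E_P[Y] < +oo)%E.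
  apply: le_lt_trans Y_sq; rewrite unlock; apply: ge0_le_integral => //.
  - by move=> t _; rewrite lee_fin.
  - by apply/measurable_EFinP; exact: measurable_funPT.
  - by apply/measurable_EFinP; apply: measurable_funX; exact: measurable_funPT.
  move=> t _; rewrite lee_fin; have /natrP[m ->] := Y_nat t.
  by rewrite -natrX ler_nat; case: m => // m; rewrite expnS expn1 leq_pmulr.
have EY0 : (0 <= 'E_P[Y])%E by exact: expectation_ge0.
rewrite -lee_fin fineK ?ge0_fin_numE// -sumEFin.
have -> : (\sum_(k < N) (tail k)%:E =
    \int[P]_t (\sum_(k < N) (\1_(Y @^-1` `]k%:R, +oo[) t)%:E))%E.
  rewrite ge0_integral_sum//.
  - apply: eq_bigr => k _; rewrite integral_indic.
    + by rewrite setIT; exact: esym (tailE k).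
    + by [].
    + exact: mY.
  - by move=> k; apply/measurable_EFinP; apply: measurable_indic; exact: mY.
rewrite expectation_def; apply: ge0_le_integral => //.
- by move=> t _; apply: sume_ge0 => k _; rewrite lee_fin.
- apply: emeasurable_sum => k; apply/measurable_EFinP.
  by apply: measurable_indic; exact: mY.
- by apply/measurable_EFinP; exact: measurable_funPT.
move=> t _; rewrite sumEFin lee_fin; have /natrP[m Ym] := Y_nat t.
have -> : \sum_(k < N) \1_(Y @^-1` `]k%:R, +oo[) t =
    (\sum_(k < N) (k < m))%:R :> R.
  rewrite natr_sum; apply: eq_bigr => k _; rewrite indicE.
  congr (nat_of_bool _)%:R.
  by apply/idP/idP; rewrite inE/= in_itv/= andbT Ym ltr_nat.
rewrite Ym ler_nat.
have -> : (\sum_(k < N) (k < m) = minn N m)%N.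
  elim: N => [|N IH]; first by rewrite big_ord0 min0n.
  by rewrite big_ord_recr/= IH; case: ltnP; lia.
exact: geq_minr.
Qed.

End Tail.

(** * Total variation from finitely many point masses *)

Section NatSupported.
Context (R : realType).

Lemma measurable_nat_set : measurable [set x : R | x \is a Num.nat].
Proof.
apply: countable_measurable => //.
apply: (@sub_countable _ _ _ (range (fun n : nat => n%:R : R))).
  by apply: subset_card_le => x /natrP[n ->]; exists n.
exact: sub_countable (card_image_le _ _) (countableP _).
Qed.

Lemma measurable_not_nat : measurable [set x : R | x \isn't a Num.nat].
Proof.
rewrite [X in measurable X](_ : _ = ~` [set x : R | x \is a Num.nat]).
  exact: measurableC measurable_nat_set.
by apply/seteqP; split => x /= /negP.
Qed.

Lemma measurable_int_image (A : set int) : measurable (intr @` A : set R).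
Proof.
apply: countable_measurable => //.
exact: sub_countable (card_image_le _ _) (countableP _).
Qed.

Lemma nat_subsetP N (Q : pred nat) (x : R) :
  (\big[setU/set0]_(k < N | Q k) [set k%:R : R]) x <->
  exists k, [/\ (k < N)%N, Q k & x = k%:R].
Proof.
rewrite big_mkcond.
rewrite -(bigcup_mkord N (fun k => if Q k then [set k%:R : R] else set0)).
split=> [[k /= kN]|[k [kN Qk xk]]]; first by case: ifP => // Qk xk; exists k.
by exists k => //=; rewrite Qk.
Qed.

Lemma mass_nat_subset (mu : probability R R) N (Q : pred nat) :
  mu (\big[setU/set0]_(k < N | Q k) [set k%:R]) =
  (\sum_(k < N | Q k) fine (mu [set k%:R]))%:E.
Proof.
rewrite measure_bigsetU_ord_cond//.
  by rewrite -sumEFin; apply: eq_bigr => k _; rewrite fineK// fin_num_measure.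
move=> k l _ _ [x [/= -> /eqP]]; rewrite eqr_nat => /eqP; exact: val_inj.
Qed.

Lemma mass_nat_cvg (mu : probability R R) :
  mu.-negligible [set x : R | x \isn't a Num.nat] ->
  (fun N => \sum_(k < N) fine (mu [set k%:R])) @ \oo --> (1 : R).
Proof.
move=> mun.
suff : EFin \o (fun N => \sum_(k < N) fine (mu [set k%:R])) @ \oo --> 1%:E.
  exact: fine_cvg.
have -> : EFin \o (fun N => \sum_(k < N) fine (mu [set k%:R])) =
    mu \o (fun N => \big[setU/set0]_(k < N) [set k%:R : R]).
  by apply/funext => N; rewrite /= (mass_nat_subset _ _ xpredT).
have U : \bigcup_N (\big[setU/set0]_(k < N) [set k%:R : R]) =
    [set x : R | x \is a Num.nat].
  apply/seteqP; split => x /=.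
    by move=> [N _ /(nat_subsetP _ xpredT)[k [_ _ ->]]]; rewrite natr_nat.
  move=> /natrP[n ->]; exists n.+1 => //.
  by apply/(nat_subsetP _ xpredT); exists n.
have -> : 1%:E = mu (\bigcup_N (\big[setU/set0]_(k < N) [set k%:R : R])).
  rewrite U; have -> : [set x : R | x \is a Num.nat] =
      ~` [set x : R | x \isn't a Num.nat].
    by apply/seteqP; split => x /=; [move=> ->|move=> /negP/negPn].
  have mn := measurable_not_nat.
  rewrite probability_setC//; have /negligibleP -> // := mun.
  by rewrite sube0.
apply: nondecreasing_cvg_mu.
- by move=> N; apply: bigsetU_measurable.
- by rewrite U; exact: measurable_nat_set.
- move=> m n mn; apply/subsetPset => x /(nat_subsetP _ xpredT)[k [km _ xk]].
  by apply/(nat_subsetP _ xpredT); exists k; split => //; exact: leq_trans km mn.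
Qed.

(** The gap between the two bounds is the mass that [mu] does not put on
    [0, ..., N - 1]. *)
Lemma mass_int_bounds (mu : probability R R) (A : set int) N :
  \sum_(k < N | `[< A k%:Z >]) fine (mu [set k%:R]) <= fine (mu (intr @` A)) <=
  1 - \sum_(k < N | ~~ `[< A k%:Z >]) fine (mu [set k%:R]).
Proof.
pose Q := fun k : nat => `[< A k%:Z >].
have mA := measurable_int_image A.
have mU (Q' : pred nat) :
    measurable (\big[setU/set0]_(k < N | Q' k) [set k%:R : R]).
  by apply: bigsetU_measurable.
have fA : mu (intr @` A) = (fine (mu (intr @` A)))%:E.
  by rewrite fineK// fin_num_measure.
apply/andP; split.
  rewrite -lee_fin -fA -(mass_nat_subset mu N Q).
  apply: le_measure; rewrite ?inE//.
  by move=> x /(nat_subsetP _ Q)[k [_ /asboolP Ak ->]]; exists k%:Z.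
rewrite lerBrDr -lee_fin EFinD -fA -(mass_nat_subset mu N (fun k => ~~ Q k)).
rewrite -measureU//; last first.
  apply/seteqP; split => x //= [[z Az <-]].
  move=> /(nat_subsetP _ (fun k => ~~ Q k))[k [_ /asboolP Ak]].
  move=> /eqP; rewrite -[k%:R]/(k%:Z%:~R) eqr_int => /eqP zk.
  by rewrite zk in Az.
exact: (mU (fun k => ~~ Q k)).
apply: probability_le1; apply: measurableU => //.
exact: (mU (fun k => ~~ Q k)).
Qed.

(** Up to tails, twice [mu A - nu A] is the sum of [mu k - nu k] over [k] in [A]
    minus the same sum over [k] outside [A], which accounts for the factor 1/2. *)
Lemma dTV_le_truncated (mu nu : probability R R) (B : \bar R) :
  mu.-negligible [set x : R | x \isn't a Num.nat] ->
  nu.-negligible [set x : R | x \isn't a Num.nat] ->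
  (forall N, (1 < N)%N ->
    ((2^-1 * \sum_(k < N) `|fine (mu [set k%:R]) - fine (nu [set k%:R])|)%:E
      <= B)%E) ->
  (dTV mu nu <= B)%E.
Proof.
move=> mun nun le_B; apply: ge_ereal_sup => _ [A _ <-].
have [mA nA] := (measurable_int_image A, measurable_int_image A).
have fA (la : probability R R) : la (intr @` A) = (fine (la (intr @` A)))%:E.
  by rewrite fineK// fin_num_measure//; exact: measurable_int_image.
rewrite (fA mu) (fA nu) -EFinB abse_EFin.
apply/lee_addgt0Pr => e e0.
have /cvgrPdist_lt/(_ e e0) [N1 _ HN1] := mass_nat_cvg mun.
have /cvgrPdist_lt/(_ e e0) [N2 _ HN2] := mass_nat_cvg nun.
pose N := maxn 2 (maxn N1 N2).
have N_gt1 : (1 < N)%N by rewrite /N leq_max.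
have h1 : `|1 - \sum_(k < N) fine (mu [set k%:R])| < e.
  by apply: HN1; rewrite /= /N !leq_max leqnn orbT.
have h2 : `|1 - \sum_(k < N) fine (nu [set k%:R])| < e.
  by apply: HN2; rewrite /= /N !leq_max leqnn !orbT.
apply: le_trans (leeD (le_B N N_gt1) (lexx _)); rewrite -EFinD lee_fin.
have /andP[ml mr] := mass_int_bounds mu A N.
have /andP[nl nr] := mass_int_bounds nu A N.
move: ml mr nl nr h1 h2.
set Q := (fun k : nat => `[< A k%:Z >]).
set a := fine (mu _); set b := fine (nu _).
rewrite !(bigID (fun k : 'I_N => Q k) xpredT)/=.
set mQ := \sum_(k < N | Q k) fine (mu _).
set mQ' := \sum_(k < N | ~~ Q k) fine (mu _).
set nQ := \sum_(k < N | Q k) fine (nu _).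
set nQ' := \sum_(k < N | ~~ Q k) fine (nu _).
have d1 : `|mQ - nQ| <=
    \sum_(k < N | Q k) `|fine (mu [set k%:R]) - fine (nu [set k%:R])|.
  by rewrite -sumrB; exact: ler_norm_sum.
have d2 : `|mQ' - nQ'| <=
    \sum_(k < N | ~~ Q k) `|fine (mu [set k%:R]) - fine (nu [set k%:R])|.
  by rewrite -sumrB; exact: ler_norm_sum.
move: d1 d2; set D1 := \sum_(k < N | Q k) `|_|.
set D2 := \sum_(k < N | ~~ Q k) `|_|.
rewrite !ler_norml !ltr_norml => /andP[? ?] /andP[? ?] ? ? ? ?.
move=> /andP[? ?] /andP[? ?].
apply/andP; split; lra.
Qed.

End NatSupported.

(** * Second differences as multiplication by (1 - X)^2 *)

Section SecondDifference.
Variables (R : realType) (N : nat).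

Definition coef_of (f : int -> R) (c : {poly R}) :=
  (forall k, (k < N)%N -> c`_k = f k%:Z) /\ (forall z : int, z < 0 -> f z = 0).

Lemma coef_of_bdiff f c : coef_of f c -> coef_of (bdiff f) ((1 - 'X) * c).
Proof.
move=> [fc f0]; split => [k kN|z z0]; last first.
  by rewrite /bdiff !f0 ?subr0//; lia.
rewrite mulrBl mul1r coefB coefXM /bdiff fc//; congr (_ - _).
case: k kN => [|k] kN /=; first by rewrite f0.
by rewrite fc ?(ltnW kN)//; congr f; lia.
Qed.

Lemma pnorm_le_l1norm f c : coef_of f c -> ((pnorm N c)%:E <= l1norm f)%E.
Proof.
move=> [fc _]; apply: esum_ge; exists (Posz @` `I_N).
  split => //; exact/finite_image/finite_II.
rewrite fsbig_image//; last by move=> k l _ _ [].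
rewrite -fsbig_ord/= -sumEFin; apply: lee_sum => k _.
by rewrite fc.
Qed.

End SecondDifference.

(** * The compound Poisson law and its generating function *)

(** Both cases of the definition at once.  When [lam = 0] the jumps of [F] are
    weighted by [0], so that [q] vanishes below degree [N] and the formula gives
    the point mass at [0]. *)
Lemma compound_poisson_law (R : realType) (lam : R) (F : R -> R)
    (mu : probability R R) :
  is_compound_poisson lam F mu -> F 0 = 0 ->
  (forall (k : nat) x, k%:R <= x < k.+1%:R -> F x = F k%:R) ->
  mu.-negligible [set x : R | x \isn't a Num.nat] /\
  forall N (q : {poly R}), q`_0 = 0 ->
    (forall k, (k.+1 < N)%N -> q`_k.+1 = lam * (F k.+1%:R - F k%:R)) ->
    forall k, (k < N)%N ->
      mu [set k%:R] = ((expR (- lam) *: expT N q)`_k)%:E.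
Proof.
have mn := @measurable_not_nat R.
move=> CP F0 F_step.
case: CP => [[lam0 muE]|[lam0 [d [T [P [Y [W [lawY cdfW indep muE]]]]]]]].
  split.
    apply/negligibleP => //; apply: etrans (muE _ mn) _.
    by rewrite diracE memNset//= => /negP; apply; exact: (natr_nat _ 0%N).
  move=> N q q0 qF k kN; apply: etrans (muE _ (measurable_set1 _)) _.
  rewrite lam0 oppr0 expR0 scale1r.
  have q00 : eqmX N q 0.
    by case=> [|l] lN; rewrite coef0 ?q0// qF// lam0 mul0r.
  rewrite (eqmX_expT q00)// expT0// coef1 diracE; congr (_%:R%:E).
  congr nat_of_bool; apply/idP/idP; rewrite inE/=.
    by move=> /esym/eqP; rewrite pnatr_eq0.
  by move=> /eqP->.
have Wn i := lattice_nat (cdfW i) F0 F_step.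
split.
  apply/negligibleP => //; apply: etrans (muE _ mn) _.
  apply: measure_negligible (random_sum_nat Y Wn).
  rewrite -[X in measurable X]setTI.
  exact: (measurable_random_sum Y W measurableT mn).
move=> N q q0 qF k kN; apply: etrans (muE _ (measurable_set1 _)) _.
have lamN0 : lam != 0 by rewrite gt_eqF.
have -> : q = lam *: (lam^-1 *: q) by rewrite scalerA divff// scale1r.
apply: (compound_poisson_pmf lam0 lawY indep) => //.
  by rewrite coefZ q0 mulr0.
move=> i [|l] lN; rewrite coefZ ?q0 ?mulr0.
  exact: lattice_pmf0 (cdfW i) F0.
rewrite qF// mulrA mulVf// mul1r; exact: lattice_pmfS (cdfW i) F_step l.
Qed.

(** With [y = exp x], the second claim reads
    [y^2 (2 / y - 1) = 1 - (y - 1)^2 <= 1]. *)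
Lemma expR2_le_geometric (R : realType) (x : R) : x < ln 2 ->
  0 < 1 - 2 * (1 - expR (- x)) /\ expR (2 * x) <= (1 - 2 * (1 - expR (- x)))^-1.
Proof.
move=> xln; have y2 : expR x < 2 by rewrite -[ltRHS](@lnK R) ?posrE// ltr_expR.
have y0 := expR_gt0 x.
have d0 : 0 < 1 - 2 * (1 - expR (- x)).
  have : 2^-1 < expR (- x) by rewrite expRN ltf_pV2 ?posrE.
  lra.
split => //; rewrite -[leRHS]mul1r ler_pdivlMr//.
rewrite mulr_natl mulr2n expRD expRN.
have -> : expR x * expR x * (1 - 2 * (1 - (expR x)^-1)) = 1 - (expR x - 1) ^+ 2.
  by field; rewrite gt_eqF.
by rewrite gerBl sqr_ge0.
Qed.

(** * The total variation bound *)

Theorem theorem9 (R : realType) (d : measure_display) (T : measurableType d)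
    (P : probability T R) (n : nat) (X : 'I_n -> {RV P >-> R})
    (X_nat : forall (i : 'I_n) (t : T), X i t \is a Num.nat)
    (X_indep : mutually_independent P (fun (i : 'I_n) (t : T) => X i t))
    (X_sq : forall i : 'I_n, ('E_P[fun t : T => (X i t ^+ 2)%R] < +oo)%E)
    (p : 'I_n -> R) (p_def : forall i : 'I_n, p i = prob_neq0 P (X i))
    (p_lt : forall i : 'I_n, p i < ln 2)
    (lam : R) (lam_def : lam = \sum_(i < n) p i)
    (F : R -> R)
    (F_def : forall x : R,
       F x = \sum_(i < n) p i / lam * cond_cdf_neq0 P (X i) x)
    (CP : probability R R)
    (CP_def : is_compound_poisson lam F CP) :
  (dTV (pushforward P (fun t : T => (\sum_(i < n) X i t)%R)) CP <=
     ((\sum_(i < n) p i ^+ 2) ^+ 2)%:E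
     + (4^-1)%:E * l1norm (bdiff (bdiff (int_pmf CP)))
       * (\sum_(i < n) fine 'E_P[X i] ^+ 2
                       / (1 - 2 * (1 - expR (- p i))))%:E)%E.
Proof.
have pE i : p i = tail (X i) 0 by rewrite p_def prob_neq0_tail.
have p0 i : 0 <= p i by rewrite pE tail_ge0.
have p1 i : p i <= 1 by rewrite pE tail0_le1.
have FE (k : nat) (x : R) : k%:R <= x < k.+1%:R -> F x =
    \sum_(i < n) p i / lam * ((tail (X i) 0 - tail (X i) k) / p i).
  move=> kx; rewrite F_def; apply: eq_bigr => i _.
  by rewrite /cond_cdf_neq0 -p_def (fine_prob_le_neq0 (X_nat i) kx).
have F0 : F 0 = 0.
  rewrite (FE 0%N) ?lexx ?ltr01// big1// => i _.
  by rewrite subrr mul0r mulr0.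
have F_step (k : nat) (x : R) : k%:R <= x < k.+1%:R -> F x = F k%:R.
  by move=> kx; rewrite (FE k)// (FE k k%:R)// lexx ltr_nat leqnn.
have F_jump (k : nat) : lam * (F k.+1%:R - F k%:R) =
    \sum_(i < n) (tail (X i) k - tail (X i) k.+1).
  have kk l : (l%:R <= l%:R :> R) && (l%:R < l.+1%:R :> R).
    by rewrite lexx ltr_nat leqnn.
  rewrite (FE _ _ (kk k)) (FE _ _ (kk k.+1)).
  rewrite -sumrB mulr_sumr; apply: eq_bigr => i _.
  have [pi0|pi0] := eqVneq (p i) 0.
    (* Here the division by [p i] yields 0, which agrees with the jump. *)
    have t0 l : tail (X i) l = 0.
      apply/eqP; rewrite eq_le tail_ge0 andbT -pi0 pE; exact: tail_le.
    by rewrite pi0 !t0; ring.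
  have lam0 : lam != 0.
    apply: contraNneq pi0; rewrite lam_def => /eqP; rewrite psumr_eq0//.
    by move=> /allP/(_ i (mem_index_enum i)).
  by field; rewrite pi0 lam0.
have [CPn CP_law] := compound_poisson_law CP_def F0 F_step.
pose q N i := jump_poly (X i) N.
pose c N := expR (- lam) *: expT N (\sum_(i < n) q N i).
have cE N k : (k < N)%N -> CP [set k%:R] = ((c N)`_k)%:E.
  apply: CP_law => [|l lN].
    by rewrite coef_sum big1// => i _; exact: jump_poly0.
  by rewrite coef_sum F_jump; apply: eq_bigr => i _; rewrite coef_poly lN.
have mS : measurable_fun setT (fun t : T => \sum_(i < n) X i t).
  by apply: measurable_sum => i; exact: measurable_funPT.
pose S : {mfun T >-> R} := mfun_Sub (mem_set mS).
have SE : (S : T -> R) = fun t => \sum_(i < n) X i t by exact: mfun_valP.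
rewrite -SE; apply: (@dTV_le_truncated R (distribution P S) CP) => //.
  apply/negligibleP; first exact: measurable_not_nat.
  apply: etrans (measure0 P); congr (P _).
  by apply/seteqP; split => t // /negP; apply; apply: rpred_sum.
move=> N N1.
have lawS k : (k < N)%N -> distribution P S [set k%:R] =
    ((\prod_(i < n) ((1 - p i)%:P + q N i))`_k)%:E.
  move=> kN.
  have [] := @sum_event_law _ _ _ P _ (fun i => X i)
    (fun i => measurable_funPT (X i)) X_indep N
    (fun i => (1 - p i)%:P + q N i) (index_enum 'I_n) [::] (fun=> setT) k _ _ _ kN.
  - by rewrite cats0 index_enum_uniq.
  - by [].
  - by move=> i _ l lN; rewrite pE; exact: jump_polyP (X_nat i) N l lN.
  move=> _; rewrite big_nil mule1 => <-.
  rewrite /distribution /pushforward; congr (P _); apply/seteqP.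
  split => t; last by case=> _ [].
  by move=> St; split => //; split.
rewrite (eq_bigr (fun k : 'I_N =>
  `|(\prod_(i < n) ((1 - p i)%:P + q N i) - c N)`_k|)); last first.
  move=> k _; rewrite coefB; congr (`|_ - _|).
    exact: (f_equal fine (lawS k (ltn_ord k))).
  by rewrite (cE N k (ltn_ord k)).
have c_coef : coef_of N (int_pmf CP) (c N).
  split => [k kN|z z0]; first by rewrite /int_pmf -[k%:Z%:~R]/(k%:R) (cE N).
  rewrite /int_pmf; suff -> : CP [set z%:~R] = 0%E by [].
  apply: measure_negligible => //; apply: negligibleS CPn => _ /= ->.
  by apply/negP => /natr_ge0; rewrite ler0z leNgt z0.
have Vl := pnorm_le_l1norm (coef_of_bdiff (coef_of_bdiff c_coef)).
rewrite mulrA -expr2 in Vl.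
have := @cpois_approx R N _ (index_enum 'I_n) p (fun i => fine 'E_P[X i]) (q N)
  (fun i => tail_poly (X i) N) (index_enum_uniq _) N1.
rewrite -lam_def -/(c N) => approx.
have {}approx : pnorm N (\prod_(i < n) ((1 - p i)%:P + q N i) - c N) <=
    2 * (\sum_(i < n) p i ^+ 2) ^+ 2 + 2^-1 * pnorm N ((1 - 'X) ^+ 2 * c N) *
      \sum_(i < n) fine 'E_P[X i] ^+ 2 * expR (2 * p i).
  apply: approx => i.
  - by rewrite p0 p1.
  - exact: jump_poly0.
  - by rewrite pE; exact: pnorm_jump_poly.
  - by rewrite pE; exact: tail_polyE.
  - exact: pnorm_tail_poly (X_nat i) (X_sq i) N.
set W := \sum_(i < n) _ / _.
set V := pnorm N _ in Vl approx.
have W0 : 0 <= W.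
  apply: sumr_ge0 => i _; have [d0 _] := expR2_le_geometric (p_lt i).
  by rewrite divr_ge0 ?sqr_ge0// ltW.
have KW : \sum_(i < n) fine 'E_P[X i] ^+ 2 * expR (2 * p i) <= W.
  apply: ler_sum => i _; have [_ ?] := expR2_le_geometric (p_lt i).
  by rewrite ler_wpM2l ?sqr_ge0.
have V0 : 0 <= V by exact: pnorm_ge0.
apply: (@le_trans _ _ ((\sum_(i < n) p i ^+ 2) ^+ 2 + 4^-1 * V * W)%:E).
  rewrite lee_fin -/(pnorm N _).
  have : V * (\sum_(i < n) fine 'E_P[X i] ^+ 2 * expR (2 * p i)) <= V * W.
    by rewrite ler_wpM2l.
  lra.
rewrite EFinD leeD2l// !EFinM; apply: lee_wpmul2r; first by rewrite lee_fin.
by apply: lee_wpmul2l; rewrite ?lee_fin.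
Qed.
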